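(* Let $(X,T)$ be a topological dynamical system, let $x\in X$, and let $k\in\mathbb N$. For any clopen sets $E_1,\ldots,E_k\subseteq X$, the following are equivalent: (1) there exists $p\in\mathcal A(X,T)$ such that $(px,p^2x,\ldots,p^kx)\in E_1\times E_2\times\cdots\times E_k$; (2) there exists an infinite subset $B\subseteq\mathbb N$ such that $B^{\oplus j}\subseteq N(x,E_j)$ for every $j=1,\ldots,k$.
   Context: $\mathbb N=\{1,2,\ldots\}$. A topological (dynamical) system is a pair $(X,T)$ with $X$ a compact metric space and $T$ a homeomorphism of $X$. For $x\in X$ and $E\subseteq X$, $N(x,E):=\{n\in\mathbb N:T^nx\in E\}$. The adherence semigroup is $\mathcal A(X,T)=\bigcap_{m=1}^{\infty}\overline{\{T^n:n\ge m\}}$, with closures in $X^X$ under the topology of pointwise convergence; its elements are maps $X\to X$, multiplied by composition, $(pq)x=p(qx)$, and $p^j$ is the $j$-fold composition. For $B\subseteq\mathbb N$ and $j\in\mathbb N$, $B^{\oplus j}:=\{\sum_{n\in F}n: F\subseteq B,\ |F|=j\}$. *)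

(* Defs.v *)
From HB Require Import structures.
From mathcomp Require Import all_boot all_order all_algebra finmap.
From mathcomp Require Import boolp classical_sets functions cardinality.
From mathcomp Require Import reals topology.

Set Implicit Arguments.
Unset Strict Implicit.
Unset Printing Implicit Defensive.

Local Open Scope classical_set_scope.

(* The natural numbers of the source start at 1: sets of natural numbers are
   sets of positive elements of [nat]. *)
Definition positive_nat : set nat := [set n | 0 < n].

Definition homeomorphism (X Y : topologicalType) (f : X -> Y) : Prop :=
  continuous f /\ exists g : Y -> X, [/\ continuous g, cancel f g & cancel g f].

Definition topological_system (R : realType) (X : metricType R) (T : X -> X)
    : Prop :=
  compact [set: X] /\ homeomorphism T.

(* N(x, E) *)
Definition return_times (X : Type) (T : X -> X) (x : X) (E : set X) : set nat :=
  [set n | positive_nat n /\ E (iter n T x)].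

(* The closures are taken in the product topology on X^X. *)
Definition adherence_semigroup (X : topologicalType) (T : X -> X)
    : set {ptws X -> X} :=
  \bigcap_(m in positive_nat)
    closure [set (iter n T : {ptws X -> X}) | n in [set n | m <= n]].

(* Sums of exactly j pairwise distinct elements of B. *)
Definition distinct_sums (B : set nat) (j : nat) : set nat :=
  [set \sum_(n <- F) n
    | F in [set F : {fset nat} | [set` F] `<=` B /\ #|` F|%fset = j]].

(* Main.v *)
(* If p is in the adherence semigroup, B is built greedily: the invariant is that
   T^(sum F) p^j x lies in E_(|F| + j) for all finite F contained in the current
   finite set. Applied with one factor p left over, it is an open condition on
   the values of p at finitely many points p^(j-1) x, so that this p may be
   replaced by some T^b with b as large as we like; b is the next element.
   Conversely, p is taken to be a cluster point in X^X of T^b, b in B: by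
   induction on j the same invariant holds for B, each step being a limit over b
   in a closed set. *)
Require Import Defs.
From mathcomp Require Import all_boot all_order all_algebra finmap.
From mathcomp Require Import boolp classical_sets functions cardinality.
From mathcomp Require Import reals topology.
Local Open Scope classical_set_scope.

Lemma open_preimage_iter (X : topologicalType) (T : X -> X) (n : nat)
    (U : set X) :
  continuous T -> open U -> open (iter n T @^-1` U).
Proof.
move=> cT; apply: (continuousP _).1; elim: n => [|n IHn] y; first exact: cvg_id.
exact: (continuous_comp (IHn y) (cT _)).
Qed.

Lemma near_eval (X : topologicalType) (p : {ptws X -> X}) (y : X) (U : set X) :
  open U -> U (p y) -> \forall q \near p, U (q y).
Proof.
move=> oU Upy.
exact: (@proj_continuous X (fun=> X) y p U (open_nbhs_nbhs (conj oU Upy))).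
Qed.

Lemma adherence_semigroupP (X : topologicalType) (T : X -> X)
    (p : {ptws X -> X}) :
  adherence_semigroup T p <-> forall (m : nat) (U : set {ptws X -> X}),
    nbhs p U -> exists2 n, m <= n & U (iter n T).
Proof.
split=> [Ap m U pU|Ap m _ U pU].
  (* The definition only admits positive bounds, so [m.+1] covers the case [m = 0]. *)
  have [_ [[n /= mn <-] Un]] := Ap m.+1 isT U pU.
  by exists n => //; exact: ltnW.
by have [n mn Un] := Ap m U pU; exists (iter n T); split => //; exists n.
Qed.

Lemma infinite_nat_geq (B : set nat) (m : nat) :
  infinite_set B -> exists2 b, B b & m <= b.
Proof.
move=> infB; apply: contrapT => noB; apply: infB.
apply: (sub_finite_set _ (finite_II m)) => b Bb /=.
by rewrite ltnNge; apply/negP => mb; apply: noB; exists b.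
Qed.

Lemma leq_sum_fset (A : {fset nat}) (n : nat) :
  n \in A -> n <= \sum_(i <- A) i.
Proof. by move=> nA; rewrite (big_fsetD1 n nA) /= leq_addr. Qed.

(** By Tychonoff [X -> X] is compact, so the sequence of [iter (b n) T], with [b n] in [B] and
    [n <= b n], has a cluster point. *)
Lemma exists_cluster_iter (X : topologicalType) (T : X -> X) (B : set nat) :
  compact [set: X] -> infinite_set B ->
  exists p : {ptws X -> X}, forall (m : nat) (U : set {ptws X -> X}),
    nbhs p U -> exists2 b, B b /\ m <= b & U (iter b T).
Proof.
move=> cX infB.
have /choice[b bB] : forall n, exists b, B b /\ n <= b.
  by move=> n; have [b Bb nb] := infinite_nat_geq B n infB; exists b.
pose u n : {ptws X -> X} := iter (b n) T.
have cXX := @tychonoff X (fun=> X) (fun=> setT) (fun=> cX).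
have [p [_ clp]] := cXX (u @ \oo)%classic _ (filterE _ (fun _ _ => I)).
exists p => m U pU.
have um : (u @ \oo)%classic [set u n | n in [set n | m <= n]].
  by exists m => // n /= mn; exists n.
have [_ [[n /= mn <-] Un]] := clp _ _ um pU.
by exists (b n) => //; split; [case: (bB n)|apply: leq_trans (bB n).2].
Qed.

(* The subtraction never truncates, since #|F| <= l.+1; E l is E_(l+1) of the
   source. *)
Definition sums_in (X : Type) (T p : X -> X) (x : X) (k : nat)
    (E : 'I_k -> set X) (S : {fset nat}) : Prop :=
  forall (l : 'I_k) (F : {fset nat}), (F `<=` S)%fset -> #|` F|%fset <= l.+1 ->
  E l (iter (\sum_(n <- F) n) T (iter (l.+1 - #|` F|%fset) p x)).

(** A subset of the enlarged set that contains [b] is [b] together with a subset of [S]; there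
    [iter b T] stands in for one factor [p]. Subsets avoiding [b] are covered by the old
    invariant. *)
Lemma sums_in_extend (X : topologicalType) (T : X -> X) (p : {ptws X -> X})
    (x : X) (k : nat) (E : 'I_k -> set X) (S : {fset nat}) :
  continuous T -> (forall i, open (E i)) -> adherence_semigroup T p ->
  sums_in X T p x k E S ->
  exists b, [/\ 0 < b, b \notin S & sums_in X T p x k E (b |` S)%fset].
Proof.
move=> cT oE /adherence_semigroupP Ap ES.
(* The pairs [c] form a finite type, so finitely many open conditions on [q] hold together near
   [p]. *)
have : \forall q \near p, forall c : 'I_k * fpowerset S,
    #|` val c.2|%fset <= c.1 ->
    E c.1 (iter (\sum_(n <- val c.2) n) T
                (q (iter (c.1 - #|` val c.2|%fset) p x))).
  refine (@filter_forall _ ('I_k * fpowerset S)%type _ (nbhs p) _ _) => -[l [F FS]] /=.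
  have [Fl|lF] := leqP #|` F|%fset l; last by apply: filterE.
  have oU : open (iter (\sum_(n <- F) n) T @^-1` E l).
    exact: open_preimage_iter.
  have pU : E l (iter (\sum_(n <- F) n) T (p (iter (l - #|` F|%fset) p x))).
    rewrite -iterS -subSn//; apply: ES; last exact: leqW.
    by rewrite -fpowersetE.
  by apply: (@filterS _ (nbhs p) _ _ _ _ (near_eval X p _ _ oU pU)) => q.
(* Exceeding the sum of [S] makes [b] positive and different from every element of [S]. *)
move/(Ap (\sum_(n <- S) n).+1) => [b Sb Eb]; exists b; split.
- exact: leq_trans Sb.
- by apply: contraL Sb => /leq_sum_fset; rewrite -leqNgt.
move=> l F FbS Fl.
have [bF|bF] := boolP (b \in F); last first.
  apply: ES => //; apply/fsubsetP => n nF.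
  have := fsubsetP FbS n nF; rewrite !inE => /orP[/eqP nb|//].
  by rewrite -nb nF in bF.
have FDS : (F `\ b)%fset \in fpowerset S.
  rewrite fpowersetE; apply/fsubsetP => n; rewrite !inE => /andP[nb nF].
  by have := fsubsetP FbS n nF; rewrite !inE (negbTE nb).
have := Eb (l, [` FDS]%fset); move: Fl.
rewrite /= (cardfsD1 b) bF add1n ltnS subSS.
by move=> Fl /(_ Fl); rewrite (big_fsetD1 b bF) /= addnC iterD.
Qed.

Lemma adherence_distinct_sums (X : topologicalType) (T : X -> X)
    (p : {ptws X -> X}) (x : X) (k : nat) (E : 'I_k -> set X) :
  continuous T -> (forall i, open (E i)) -> adherence_semigroup T p ->
  (forall i : 'I_k, E i (iter i.+1 p x)) ->
  exists B : set nat, [/\ B `<=` positive_nat, infinite_set B &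
    forall i : 'I_k, distinct_sums B i.+1 `<=` return_times T x (E i)].
Proof.
move=> cT oE Ap Ep.
(* The choice function must be total; 0 is a dummy value where the invariant fails. *)
have /choice[g gP] : forall S, exists b, sums_in X T p x k E S ->
    [/\ 0 < b, b \notin S & sums_in X T p x k E (b |` S)%fset].
  move=> S; have [ES|nES] := pselect (sums_in X T p x k E S); last by exists 0.
  by have [b ?] := sums_in_extend X T p x k E S cT oE Ap ES; exists b.
pose S n := iter n (fun S => g S |` S)%fset fset0.
have ES n : sums_in X T p x k E (S n).
  elim: n => [|n IHn]; last by have [] := gP _ IHn.
  by move=> l F; rewrite fsubset0 => /eqP -> _; rewrite cardfs0 big_seq_fset0.
have Smono : {homo S : m n / m <= n >-> (m `<=` n)%fset}.
  apply: homo_leq => [A|A B C|n]; [exact: fsubset_refl|exact: fsubset_trans|].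
  exact: fsubsetU1.
pose B := [set n | exists m, n \in S m].
have Bpos : B `<=` positive_nat.
  move=> n [m]; elim: m => [|m IHm]; first by rewrite inE.
  by rewrite !inE => /orP[/eqP ->|/IHm//]; have [] := gP _ (ES m).
(* A finite subset of the increasing union lies in a single stage: remove one element, and take the
   later of two stages. *)
have Bfin (F : {fset nat}) : [set` F] `<=` B -> exists m, (F `<=` S m)%fset.
  elim/finSet_rect: F => F IHF FB.
  have [->|[n nF]] := fset_0Vmem F; first by exists 0; rewrite fsub0set.
  have [|m1 Fm1] := IHF _ (fproperD1 nF).
    by move=> i /=; rewrite !inE => /andP[_]; exact: FB.
  have [m2 nm2] := FB n nF; exists (maxn m1 m2).
  rewrite -(fsetD1K nF) fsubUset fsub1set.
  rewrite (fsubsetP (Smono _ _ (leq_maxr m1 m2)) _ nm2).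
  exact: fsubset_trans Fm1 (Smono _ _ (leq_maxl m1 m2)).
exists B; split => //.
  (* Each stage adds a new element, so [S n] has at least [n] of them. *)
  apply/infinite_set_fsetP => n; exists (S n); first by move=> i iS; exists n.
  elim: n => // n IHn; rewrite /= cardfsU1.
  by have [_ -> _] := gP _ (ES n); rewrite add1n.
move=> i _ [F [FB Fi] <-]; split.
  have [F0|[n nF]] := fset_0Vmem F; first by rewrite F0 cardfs0 in Fi.
  exact: leq_trans (Bpos n (FB n nF)) (leq_sum_fset F n nF).
have [m Fm] := Bfin F FB.
(* Since [F] has [i.+1] elements, no factor [p] remains in the invariant. *)
by have := ES m i F Fm; rewrite Fi subnn => /(_ (leqnn _)).
Qed.

Lemma distinct_sums_adherence (X : topologicalType) (T : X -> X) (x : X)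
    (k : nat) (E : 'I_k -> set X) (B : set nat) :
  compact [set: X] -> continuous T -> (forall i, closed (E i)) ->
  infinite_set B ->
  (forall i : 'I_k, distinct_sums B i.+1 `<=` return_times T x (E i)) ->
  exists p : {ptws X -> X}, adherence_semigroup T p /\
    forall i : 'I_k, E i (iter i.+1 p x).
Proof.
move=> cX cT cE infB BE.
have [p clp] := exists_cluster_iter X T B cX infB.
exists p; split.
  by apply/adherence_semigroupP => m U /(clp m)[b [_ mb] Ub]; exists b.
(* Here [j] counts the factors [p] left: [j = 0] is the hypothesis on sums, and empty [F] with
   [j = l.+1] is the goal. *)
have H j (l : 'I_k) (F : {fset nat}) : [set` F] `<=` B ->
    (#|` F|%fset + j)%N = l.+1 ->
    E l (iter (\sum_(n <- F) n) T (iter j p x)).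
  elim: j F => [|j IHj] F FB Fl.
    have [] // : return_times T x (E l) (\sum_(n <- F) n).
    by apply: BE; exists F => //; split => //; rewrite -Fl addn0.
  (* Failure is an open condition on the outermost [p], so it persists for some [iter b T] with [b]
     in [B] outside [F], against the induction hypothesis for [F] enlarged by [b]. *)
  apply: contrapT => nE.
  have oU : open (iter (\sum_(n <- F) n) T @^-1` (~` E l)).
    by apply: open_preimage_iter => //; rewrite openC.
  have [b [Bb Fb]] :=
    clp (\sum_(n <- F) n).+1 _ (near_eval X p (iter j p x) _ oU nE).
  move=> nEb; apply: nEb => /=; rewrite -iterD.
  have bF : b \notin F.
    by apply: contraL Fb => /leq_sum_fset; rewrite -leqNgt.
  rewrite addnC -(big_fsetU1 _ (fun n => n) bF); apply: IHj.
    by move=> n /=; rewrite !inE => /orP[/eqP ->//|]; exact: FB.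
  by rewrite cardfsU1 bF add1n addSnnS.
move=> i; have := H i.+1 i fset0; rewrite cardfs0 big_seq_fset0; exact.
Qed.

(* The sets E_1, ..., E_k are E 0, ..., E (k - 1): E i stands for E_(i+1). *)
Theorem theorem1p1 (R : realType) (X : metricType R) (T : X -> X)
    (TS : topological_system T) (x : X) (k : nat) (k_gt0 : 0 < k)
    (E : 'I_k -> set X) (E_clopen : forall i, clopen (E i)) :
  (exists p : X -> X, adherence_semigroup T p /\
    forall i : 'I_k, E i (iter i.+1 p x)) <->
  (exists B : set nat, [/\ B `<=` positive_nat, infinite_set B &
    forall i : 'I_k, distinct_sums B i.+1 `<=` return_times T x (E i)]).
Proof.
have [cX [cT _]] := TS; split=> [[p [Ap Ep]]|[B [_ infB BE]]].
  by apply: (adherence_distinct_sums X T p) => // i; case: (E_clopen i).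
have cE i : closed (E i) by case: (E_clopen i).
exact: distinct_sums_adherence cX cT cE infB BE.
Qed.
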